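(* Every tree-like grand-coalition-first action model is $z$-representable by a tree-like single-coalition-first neighborhood model.
   Context: $AG$ is a finite nonempty set of agents, $AP$ a countable set of atomic propositions. For a nonempty set $AC$ and $C\subseteq AG$, $JA_C$ is the set of functions $\sigma_C:C\to AC$ ($JA_\emptyset=\{\emptyset\}$); $\sigma_C\subseteq\sigma_{AG}$ means $\sigma_C$ is the restriction of $\sigma_{AG}$ to $C$. A grand-coalition-first action model is $M=(ST,AC,out_{AG},L)$ with $ST,AC$ nonempty, $out_{AG}:ST\times JA_{AG}\to\mathcal P(ST)$, $L:ST\to\mathcal P(AP)$. It determines $out_C(s,\sigma_C)=\bigcup\{out_{AG}(s,\sigma_{AG})\mid\sigma_C\subseteq\sigma_{AG}\}$, $av_C(s)=\{\sigma_C\mid out_C(s,\sigma_C)\neq\emptyset\}$, $AE_C(s)=\{out_C(s,\sigma_C)\mid\sigma_C\in av_C(s)\}$. An $AG$-history from $s_0$ to $s_n$ is $(s_0)$ (from $s_0$ to $s_0$) or $(s_0,\sigma^1,s_1,\dots,\sigma^n,s_n)$, $n\ge1$, with $\sigma^{i+1}\in av_{AG}(s_i)$, $s_{i+1}\in out_{AG}(s_i,\sigma^{i+1})$. $M$ is tree-like if there is $r\in ST$ such that for every $s\in ST$ there is a unique $AG$-history from $r$ to $s$. A single-coalition-first neighborhood model is $N=(ST,suc,\{nei_a\}_{a\in AG},L)$ with $suc:ST\to\mathcal P(ST)$ and each $nei_a(s)\subseteq\mathcal P(ST)$ a cover of $suc(s)$ (union $suc(s)$, $\emptyset\notin nei_a(s)$).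 With $\Delta_1\odot\Delta_2=\{Y_1\cap Y_2\mid Y_i\in\Delta_i,Y_1\cap Y_2\neq\emptyset\}$ (extended to finitely many families, $\bigodot\{\Delta\}=\Delta$): $nei_C(s)=\emptyset$ if $suc(s)=\emptyset$; $\{suc(s)\}$ if $suc(s)\neq\emptyset$, $C=\emptyset$; $\bigodot\{nei_a(s)\mid a\in C\}$ otherwise. A $C$-history in $N$ from $s_0$ to $s_n$ is $(s_0)$ or $(s_0,Y_1,s_1,\dots,Y_n,s_n)$, $n\ge1$, with $Y_{i+1}\in nei_C(s_i)$, $s_{i+1}\in Y_{i+1}$. $N$ is tree-like if there is $r\in ST$ such that for every $a\in AG$ and $s\in ST$ there is a unique $\{a\}$-history from $r$ to $s$. $M$ is $z$-representable by $N$ if they share $ST$ and $L$ and $AE_C=nei_C$ for all $C\subseteq AG$. *)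

(* Defs.v *)
From mathcomp Require Import all_boot.
From mathcomp Require Import boolp classical_sets.

Set Implicit Arguments.
Unset Strict Implicit.
Unset Printing Implicit Defensive.

Local Open Scope classical_set_scope.

(* [classical_sets] shadows the [set0] and [setT] of [finset]; coalitions are
   finite sets of agents, whereas sets of states are classical sets. *)
Notation grand AG := (@finset.setTfor AG).

Definition JA (AG : finType) (AC : Type) (C : {set AG}) : Type :=
  {a : AG | a \in C} -> AC.

Definition restricts (AG : finType) (AC : Type) (C : {set AG})
    (sC : JA AC C) (sAG : JA AC (grand AG)) : Prop :=
  forall (a : AG) (aC : a \in C),
    sC (exist _ a aC) = sAG (exist _ a (finset.in_setT a)).

(* A history [(s0, l1, s1, ..., ln, sn)] is encoded by its starting state [s0]
   and the sequence [:: (l1, s1); ...; (ln, sn)]. *)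
Fixpoint is_history (ST Lb : Type) (step : ST -> Lb -> ST -> Prop)
    (s : ST) (h : seq (Lb * ST)) (t : ST) : Prop :=
  if h is (l, s1) :: h' then step s l s1 /\ is_history step s1 h' t
  else s = t.

(* Both kinds of models are indexed by their set of states, so that two models
   over the same [ST] share it by construction. *)
Record action_model (AG : finType) (AP : countType) (ST : Type) := ActionModel {
  am_AC : Type;
  am_ST_nonempty : [set: ST] !=set0;
  am_AC_nonempty : [set: am_AC] !=set0;
  am_outAG : ST -> JA am_AC (grand AG) -> set ST;
  am_label : ST -> set AP
}.

Section ActionModel.
Variables (AG : finType) (AP : countType) (ST : Type).
Variable M : action_model AG AP ST.

Definition am_out (C : {set AG}) (s : ST) (sC : JA (am_AC M) C) : set ST :=
  \bigcup_(sAG in [set sAG | restricts sC sAG]) am_outAG s sAG.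

Definition am_av (C : {set AG}) (s : ST) : set (JA (am_AC M) C) :=
  [set sC | am_out s sC !=set0].
Arguments am_av C s _ : clear implicits.

Definition am_AE (C : {set AG}) (s : ST) : set (set ST) :=
  [set am_out s sC | sC in am_av C s].

Definition am_history (s : ST) (h : seq (JA (am_AC M) (grand AG) * ST))
    (t : ST) : Prop :=
  is_history (fun u sAG v => am_av (grand AG) u sAG /\ am_outAG u sAG v) s h t.

Definition am_tree_like : Prop :=
  exists r : ST, forall s : ST, exists! h, am_history r h s.

End ActionModel.

Definition odot (ST : Type) (D1 D2 : set (set ST)) : set (set ST) :=
  [set Y1 `&` Y2 | Y1 in D1 & Y2 in D2] `&` [set Y | Y !=set0].

Lemma odotC (ST : Type) : commutative (@odot ST).
Proof.
by move=> D1 D2; apply/seteqP; split=> Y [[Y1 h1 [Y2 h2 <-]] n];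
  split=> //; exists Y2 => //; exists Y1 => //; rewrite setIC.
Qed.

Lemma odotA (ST : Type) : associative (@odot ST).
Proof.
move=> D1 D2 D3; apply/seteqP; split=> Y.
- move=> [[Y1 h1 [_ [[Y2 h2 [Y3 h3 <-]] _] <-]] n]; split=> //.
  rewrite setIA in n *.
  exists (Y1 `&` Y2); last by exists Y3.
  split; first by exists Y1 => //; exists Y2.
  by case: n => x [h _]; exists x.
- move=> [[_ [[Y1 h1 [Y2 h2 <-]] _] [Y3 h3 <-]] n]; split=> //.
  rewrite -setIA in n *.
  exists Y1 => //; exists (Y2 `&` Y3) => //.
  split; first by exists Y2 => //; exists Y3.
  by case: n => x [_ h]; exists x.
Qed.

(* By [odotA] and [odotC] the order of the families is irrelevant. The value on
   the empty sequence is a dummy. *)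
Definition bigodot (ST : Type) (Ds : seq (set (set ST))) : set (set ST) :=
  if Ds is D :: Ds' then foldl (@odot ST) D Ds' else set0.

Definition is_cover (ST : Type) (D : set (set ST)) (X : set ST) : Prop :=
  \bigcup_(Y in D) Y = X /\ ~ D set0.

Record nbhd_model (AG : finType) (AP : countType) (ST : Type) := NbhdModel {
  nm_ST_nonempty : [set: ST] !=set0;
  nm_suc : ST -> set ST;
  nm_nei1 : AG -> ST -> set (set ST);
  nm_nei1_cover : forall (a : AG) (s : ST), is_cover (nm_nei1 a s) (nm_suc s);
  nm_label : ST -> set AP
}.

Section NbhdModel.
Variables (AG : finType) (AP : countType) (ST : Type).
Variable N : nbhd_model AG AP ST.

(* The families are indexed by the members of [C]: if two agents have the same
   family, it occurs twice in the product. *)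
Definition nm_nei (C : {set AG}) (s : ST) : set (set ST) :=
  if `[< nm_suc N s = set0 >] then set0
  else if C == finset.set0 then [set nm_suc N s]
  else bigodot [seq nm_nei1 N a s | a <- enum C].

Definition nm_history (C : {set AG}) (s : ST) (h : seq (set ST * ST))
    (t : ST) : Prop :=
  is_history (fun u Y v => nm_nei C u Y /\ Y v) s h t.

Definition nm_tree_like : Prop :=
  exists r : ST, forall (a : AG) (s : ST),
    exists! h, nm_history [set a]%SET r h s.

End NbhdModel.

Definition z_representable (AG : finType) (AP : countType) (ST : Type)
    (M : action_model AG AP ST) (N : nbhd_model AG AP ST) : Prop :=
  am_label M = nm_label N /\ forall C : {set AG}, am_AE M C = nm_nei N C.

(* Main.v *)
(** In a tree-like action model two joint actions with a common outcome at a
    state coincide, since both extend the history leading to that state. Hence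
    [out_C(s, c|C)] is the intersection of the [out_{a}(s, c|{a})] for [a] in
    [C], so the neighborhood model with [nei_a = AE_{a}] and [suc = out_∅]
    represents [M]. Replacing each joint action of an [AG]-history by the
    neighborhood that agent [a] forces turns [AG]-histories of [M] into
    [{a}]-histories of [N], and every [{a}]-history arises in this way; so the
    uniqueness of histories is inherited. *)
Require Import Defs.
From mathcomp Require Import all_boot.
From mathcomp Require Import boolp classical_sets.

Set Implicit Arguments.
Unset Strict Implicit.
Unset Printing Implicit Defensive.

Local Open Scope classical_set_scope.

Lemma is_history_rcons (ST Lb : Type) (step : ST -> Lb -> ST -> Prop) s h t l v :
  is_history step s h t -> step t l v -> is_history step s (rcons h (l, v)) v.
Proof.
elim: h s => [s /= -> // | [l1 s1] h IH s /= [st1 hh] stv].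
by split=> //; apply: IH.
Qed.

(** [f] also takes the current state, since the neighborhood forced by an action depends on where it
    is played. *)
Fixpoint relabel (ST L1 L2 : Type) (f : ST -> L1 -> L2) (s : ST)
    (h : seq (L1 * ST)) : seq (L2 * ST) :=
  if h is (l, s1) :: h' then (f s l, s1) :: relabel f s1 h' else [::].

Section Relabel.
Variables (ST L1 L2 : Type) (f : ST -> L1 -> L2).
Variables (step1 : ST -> L1 -> ST -> Prop) (step2 : ST -> L2 -> ST -> Prop).
Hypothesis stepE :
  forall u l v, step2 u l v <-> exists2 k, step1 u k v & l = f u k.

Lemma is_history_relabel s h t :
  is_history step1 s h t -> is_history step2 s (relabel f s h) t.
Proof.
elim: h s => [//|[l s1] h IH] s /= [st hh]; split; last exact: IH.
by apply/stepE; exists l.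
Qed.

Lemma is_history_unrelabel s h2 t : is_history step2 s h2 t ->
  exists2 h1, is_history step1 s h1 t & h2 = relabel f s h1.
Proof.
elim: h2 s => [|[l s1] h IH] s /= => [->|[/stepE[k st ->] /IH[h1 hh ->]]].
  by exists [::].
by exists ((k, s1) :: h1).
Qed.

(** [f] may identify labels; uniqueness survives because every [step2]-history is the relabeling of
    some [step1]-history, and there is only one of these. *)
Lemma unique_history_relabel s t :
  (exists! h, is_history step1 s h t) -> exists! h, is_history step2 s h t.
Proof.
case=> h [hh uh]; exists (relabel f s h); split.
  exact: is_history_relabel.
by move=> h2 /is_history_unrelabel[h1 /uh <- ->].
Qed.

End Relabel.

Lemma bigodot_rcons (ST : Type) (Ds : seq (set (set ST))) D : Ds != [::] ->
  bigodot (rcons Ds D) = odot (bigodot Ds) D.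
Proof. by case: Ds => //= D0 Ds _; rewrite foldl_rcons. Qed.

Lemma bigcap_seq_rcons (ST : Type) (I : choiceType) (F : I -> set ST) l i :
  \bigcap_(j in [set` rcons l i]) F j =
  (\bigcap_(j in [set` l]) F j) `&` F i.
Proof. by rewrite !bigcap_seq -cats1 big_cat big_seq1. Qed.

(** As [l] has no duplicates, a single function [F] can record the members picked. Discarding empty
    intersections along the fold loses nothing: each partial intersection contains the final one. *)
Lemma bigodotP (ST : Type) (I : choiceType) (D : I -> set (set ST)) (l : seq I)
    (Y : set ST) :
  (forall i, ~ D i set0) -> uniq l -> l != [::] ->
  bigodot [seq D i | i <- l] Y <->
  exists F, [/\ forall i, i \in l -> D i (F i),
    Y = \bigcap_(i in [set` l]) F i & Y !=set0].
Proof.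
move=> D0; elim/last_ind: l Y => [//|l i IH] Y.
rewrite rcons_uniq map_rcons => /andP[il ul] _.
have [->|l0] := eqVneq l [::].
  have bc1 (F : I -> set ST) : \bigcap_(j in [set` [:: i]]) F j = F i.
    by rewrite set_cons1 bigcap_set1.
  split=> /= [DY|[F [DF -> _]]]; last by rewrite bc1; apply: DF; rewrite mem_head.
  exists (fun=> Y); rewrite bc1; split=> // [j|].
    by rewrite inE => /eqP->.
  by apply/set0P/eqP => Y0; apply: (D0 i); rewrite -Y0.
rewrite bigodot_rcons; last by case: (l) l0.
split.
- move=> [[Y1 /(IH _ ul l0)[F [DF Y1E _]] [Y2 DY2 <-]] n].
  have Fl j : j \in l -> (if j == i then Y2 else F j) = F j.
    by case: eqVneq => // ->; rewrite (negPf il).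
  exists (fun j => if j == i then Y2 else F j); split=> //.
    move=> j; rewrite mem_rcons inE; case: eqVneq => [-> //|_ /=]; exact: DF.
  by rewrite bigcap_seq_rcons eqxx Y1E (eq_bigcapr Fl).
- move=> [F [DF]]; rewrite bigcap_seq_rcons => YE n.
  split=> //; exists (\bigcap_(j in [set` l]) F j).
    apply/(IH _ ul l0); exists F; split=> //.
      by move=> j jl; apply: DF; rewrite mem_rcons inE jl orbT.
    by case: n => x; rewrite YE => -[h _]; exists x.
  by exists (F i) => //; apply: DF; rewrite mem_rcons mem_head.
Qed.

(** Total functions on [AG] stand in for joint actions, so that actions of different coalitions can
    be compared without membership proofs. *)
Definition profile_res (AG : finType) (AC : Type) (C : {set AG})
  (c : AG -> AC) : JA AC C := fun x => c (sval x).
Arguments profile_res {AG AC} C c _ /.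

Section ActionModel.
Variables (AG : finType) (AP : countType) (ST : Type).
Variable M : action_model AG AP ST.
Implicit Types (C : {set AG}) (c d : AG -> am_AC M).
Implicit Types sAG : JA (am_AC M) (grand AG).

Definition profile_out s c : set ST := am_outAG s (profile_res (grand AG) c).

Lemma restricts_profileP C (sC : JA (am_AC M) C) sAG :
  restricts sC sAG ->
  exists c, sAG = profile_res (grand AG) c /\ sC = profile_res C c.
Proof.
move=> r; exists (fun a => sAG (exist _ a (finset.in_setT a))); split.
  by apply/funext => -[a ain]; congr sAG; congr exist; exact: bool_irrelevance.
by apply/funext => -[a ain]; rewrite r.
Qed.

Lemma am_out_profileP C s c t :
  am_out s (profile_res C c) t <->
  exists d, {in C, d =1 c} /\ profile_out s d t.
Proof.
split.
  move=> [sAG /restricts_profileP[d [-> e]] o]; exists d; split=> //.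
  by move=> a aC; have := congr1 (@^~ (exist _ a aC)) e.
move=> [d [dc o]]; exists (profile_res (grand AG) d) => // a aC /=.
by rewrite dc.
Qed.

(** An available action has an outcome, hence a grand action extending it, which supplies [c]. *)
Lemma am_AE_profileP C s Y :
  am_AE M C s Y <-> Y !=set0 /\ exists c, Y = am_out s (profile_res C c).
Proof.
split=> [[sC n <-]|[n [c Yc]]].
  split=> //; case: n => t [sAG /restricts_profileP[c [_ ->]] _].
  by exists c.
by exists (profile_res C c) => //; rewrite /am_av /= -Yc.
Qed.

Lemma am_out_grand s sAG : am_out s sAG = am_outAG s sAG.
Proof.
apply/seteqP; split=> t.
  by move=> [sAG' /restricts_profileP[c [-> ->]]].
move=> o; exists sAG => // a aC; congr sAG; congr exist.
exact: bool_irrelevance.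
Qed.

Lemma am_av_grandP s sAG t : am_outAG s sAG t -> am_av (C := grand AG) s sAG.
Proof. by move=> o; exists t; rewrite am_out_grand. Qed.

Lemma am_AE_neq0 C s : ~ am_AE M C s set0.
Proof. by case/am_AE_profileP => -[]. Qed.

(** This is the outcome set of the empty coalition, as [am_out_set0] shows. *)
Definition am_suc s : set ST := \bigcup_c profile_out s c.

Lemma am_out_suc C s c : am_out s (profile_res C c) `<=` am_suc s.
Proof. by move=> t /am_out_profileP[d [_ o]]; exists d. Qed.

Lemma am_out_set0 s c : am_out s (profile_res finset.set0 c) = am_suc s.
Proof.
apply/seteqP; split; first exact: am_out_suc.
move=> t [d _ o]; apply/am_out_profileP; exists d; split=> // a.
by rewrite inE.
Qed.

Lemma am_AE_cover C s : is_cover (am_AE M C s) (am_suc s).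
Proof.
split; last exact: am_AE_neq0.
apply/seteqP; split=> t.
  by move=> [Y /am_AE_profileP[_ [c ->]] /am_out_suc].
move=> [c _ o].
have ot : am_out s (profile_res C c) t by apply/am_out_profileP; exists c.
exists (am_out s (profile_res C c)) => //.
by apply/am_AE_profileP; split; [exists t | exists c].
Qed.

Definition am_nbhd : nbhd_model AG AP ST :=
  NbhdModel (am_ST_nonempty M) (fun a => am_AE_cover [set a]%SET)
    (@am_label _ _ _ M).

Hypothesis M_tree : am_tree_like M.

Lemma tree_profile_out_inj s c d t :
  profile_out s c t -> profile_out s d t -> c = d.
Proof.
case: (M_tree) => r Hr oc od; have [h [hh _]] := Hr s.
have [h0 [_ u]] := Hr t.
have step c' (o : profile_out s c' t) :
    h0 = rcons h (profile_res (grand AG) c', t).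
  by apply: u; apply: is_history_rcons hh _; split=> //; exact: am_av_grandP o.
have /rcons_inj[e] := etrans (esym (step _ oc)) (step _ od).
apply/funext => a.
by have := congr1 (@^~ (exist _ a (finset.in_setT a))) e => /= ->.
Qed.

Lemma tree_am_out_bigcap C s c : C != finset.set0 ->
  am_out s (profile_res C c) =
  \bigcap_(a in [set` enum C]) am_out s (profile_res [set a]%SET c).
Proof.
move=> /set0Pn[b bC]; apply/seteqP; split=> t.
  move=> /am_out_profileP[d [dc o]] a /=; rewrite mem_enum => aC.
  apply/am_out_profileP; exists d; split=> // a'.
  by rewrite inE => /eqP->; apply: dc.
(* The profile [d] found for one member [b] serves all of [C]: the profile [e] found for [a] also
   leads to [t], so it equals [d], and thus [d] agrees with [c] at [a]. *)
move=> H; have := H b; rewrite /= mem_enum => /(_ bC)/am_out_profileP[d [_ o]].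
apply/am_out_profileP; exists d; split=> // a aC.
have := H a; rewrite /= mem_enum => /(_ aC)/am_out_profileP[e [ec oe]].
by rewrite (tree_profile_out_inj o oe) ec// inE.
Qed.

Lemma tree_am_AE_bigodot C s : C != finset.set0 ->
  am_AE M C s = bigodot [seq am_AE M [set a]%SET s | a <- enum C].
Proof.
move=> C0; apply/seteqP.
have enumC0 : enum C != [::].
  by rewrite -size_eq0 -cardE cards_eq0.
have bP Y := bigodotP (D := fun a => am_AE M [set a]%SET s) Y
  (fun a => @am_AE_neq0 _ s) (enum_uniq C) enumC0.
split=> Y.
  move=> /am_AE_profileP[n [c Yc]]; apply/bP.
  exists (fun a => am_out s (profile_res [set a]%SET c)); split=> //.
    move=> a aC; apply/am_AE_profileP; split; last by exists c.
    by case: n => t; rewrite Yc (tree_am_out_bigcap _ _ C0) => /(_ a aC); exists t.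
  by rewrite Yc tree_am_out_bigcap.
move=> /bP[F [DF YF n]].
(* [g a] is a profile whose restriction to [a] forces [F a]; outside [C] it is arbitrary. *)
have /choice[g gP] a : exists c : AG -> am_AC M,
    a \in enum C -> F a = am_out s (profile_res [set a]%SET c).
  case: (boolP (a \in enum C)) => [/DF/am_AE_profileP[_ [c ->]]|_].
    by exists c.
  by have [x _] := am_AC_nonempty M; exists (fun=> x).
(* Diagonal profile: each agent plays its own part of the profile chosen for it. *)
apply/am_AE_profileP; split=> //; exists (fun a => g a a).
rewrite YF tree_am_out_bigcap//; apply: eq_bigcapr => a /= aC.
rewrite gP//; congr am_out; apply/funext => -[a' /= a'a].
by move: a'a; rewrite inE => /eqP->.
Qed.

Lemma tree_am_AE_nei C : am_AE M C = nm_nei am_nbhd C.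
Proof.
apply/funext => s; rewrite /nm_nei /=; case: asboolP => [suc0|suc_neq0].
  apply/seteqP; split=> // Y /am_AE_profileP[[t Yt] [c Yc]].
  by move: Yt; rewrite Yc => /am_out_suc; rewrite suc0.
case: eqVneq => [->|/tree_am_AE_bigodot -> //].
apply/seteqP; split=> Y.
  by case/am_AE_profileP => _ [c ->]; rewrite /= am_out_set0.
move=> /= ->; apply/am_AE_profileP; split; first exact/set0P/eqP.
have [x _] := am_AC_nonempty M.
by exists (fun=> x); rewrite am_out_set0.
Qed.

Lemma tree_am_nbhd : nm_tree_like am_nbhd.
Proof.
case: (M_tree) => r Hr; exists r => a s; rewrite /nm_history.
have := Hr s; rewrite /am_history.
(* A grand action is relabeled by the outcome set of its component for [a]. *)
apply: (@unique_history_relabel _ _ _ (fun u sAG =>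
  am_out u (profile_res [set a]%SET
    (fun b => sAG (exist _ b (finset.in_setT b)))))) => u Y v.
rewrite -tree_am_AE_nei; split.
  (* Since [v] lies in the neighborhood, some profile [d] with the same action of [a] leads to [v];
     it is the grand action to be relabeled. *)
  move=> [/am_AE_profileP[_ [c ->]] /am_out_profileP[d [dc o]]].
  exists (profile_res (grand AG) d); first by split=> //; exact: am_av_grandP o.
  congr am_out; apply/funext => -[b /= ba].
  by rewrite dc.
move=> [sAG [_ o] ->].
have ov : am_out u (profile_res [set a]%SET
    (fun b => sAG (exist _ b (finset.in_setT b)))) v.
  by exists sAG.
by split=> //; apply/am_AE_profileP; split; [exists v | eexists].
Qed.

End ActionModel.

Theorem theorem6p9 (AG : finType) (AG_nonempty : 0 < #|AG|) (AP : countType)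
    (ST : Type) (M : action_model AG AP ST) :
  am_tree_like M ->
  exists N : nbhd_model AG AP ST, nm_tree_like N /\ z_representable M N.
Proof.
move=> M_tree; exists (am_nbhd M); split; first exact: tree_am_nbhd.
by split=> // C; exact: tree_am_AE_nei.
Qed.
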